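(* Let $(P,\le)$ be a Borel poset whose incompatibility relation $\{(x,y)\in P^2: x,y \text{ incompatible}\}$ is Borel. Suppose there are an integer $k$ and a countable partition $P=\bigcup_n P_n$ into Borel subsets such that for every $n$, every antichain $A\subseteq P_n$ has size $<k$. Then $P$ is Borel $\sigma$-linked, i.e. there is a countable partition of $P$ into Borel subsets each of which is linked.
   Context: A Borel poset is a partial order $(P,\le)$ where $P$ is a Polish (or standard Borel) space and $\le$ is a Borel subset of $P^2$. Elements $x,y\in P$ are compatible if there is $z\in P$ with $z\le x$ and $z\le y$, and incompatible otherwise. An antichain is a pairwise incompatible subset; a subset is linked if any two of its elements are compatible. *)

(* Defs.v *)
From HB Require Import structures.
From mathcomp Require Import all_boot all_order all_algebra.
From mathcomp Require Import all_classical all_reals all_analysis.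

Set Implicit Arguments.
Unset Strict Implicit.
Unset Printing Implicit Defensive.

Import Order.TTheory.

Local Open Scope classical_set_scope.
Local Open Scope card_scope.

Definition separable (T : topologicalType) : Prop :=
  exists2 S : set T, countable S & dense S.

Definition homeomorphism (T U : topologicalType) (f : T -> U) : Prop :=
  exists g : U -> T,
    [/\ cancel f g, cancel g f, continuous f & continuous g].

(* [completeType] is pointed, which would exclude the empty space, so
   completeness is stated directly; the condition is that of
   [Uniform_isComplete]. *)
Definition complete_space (T : uniformType) : Prop :=
  forall F : set_system T, ProperFilter F -> cauchy F -> exists l : T, F --> l.

Definition completely_metrizable (R : realType) (T : topologicalType) : Prop :=
  exists (M : metricType R) (f : T -> M), homeomorphism f /\ complete_space M.

(* [R] only serves as the codomain of the metric. A standard Borel space is the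
   Borel structure of some Polish topology, and Borel sets of its square are
   those of the square of any such topology. *)
Definition polish (R : realType) (T : topologicalType) : Prop :=
  separable T /\ completely_metrizable R T.

(* Used on a product space, [borel] refers to the product topology. *)
Definition borel (T : topologicalType) (A : set T) : Prop := <<s open >> A.

Section Poset.
Local Open Scope order_scope.
Variables (d : Order.disp_t) (P : porderType d).

Definition compatible (x y : P) : Prop := exists z : P, z <= x /\ z <= y.

Definition incompatible (x y : P) : Prop := ~ compatible x y.

Definition antichain (A : set P) : Prop :=
  forall x y : P, A x -> A y -> x <> y -> incompatible x y.

Definition linked (A : set P) : Prop :=
  forall x y : P, A x -> A y -> compatible x y.

End Poset.

Definition card_less (T : Type) (A : set T) (k : nat) : Prop :=
  exists2 m : nat, (m < k)%N & A #= `I_m.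

Definition borel_poset (R : realType) (d : Order.disp_t)
    (P : POrderedTopological.type d) : Prop :=
  polish R P /\ borel [set xy : (P * P)%type | (xy.1 <= xy.2)%O].

(* The pieces of a [partition] are nonempty; letting [D] be any set of naturals
   allows finitely many pieces, and none when the space is empty. *)
Definition countable_borel_partition (T : topologicalType) (D : set nat)
    (F : nat -> set T) : Prop :=
  partition D F [set: T] /\ (forall n, D n -> borel (F n)).

Definition borel_sigma_linked (d : Order.disp_t)
    (P : POrderedTopological.type d) : Prop :=
  exists (D : set nat) (F : nat -> set P),
    countable_borel_partition D F /\ (forall n, D n -> linked (F n)).

(* Main.v *)
Require Import Defs.
From HB Require Import structures.
From mathcomp Require Import all_boot all_order all_algebra.
From mathcomp Require Import all_classical all_reals all_analysis.
From mathcomp Require Import lra.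

(** Write m_n(z) for the largest size of an antichain of P_n below z. Every
    element has an element z below it such that j = max_n m_n is constant on
    the cone of z. For such a stable z, two elements w, w' <= z with
    m_n(w) = m_n(w') = j are compatible: otherwise the union of antichains
    below them would be an antichain of P_n of size 2j > j below z. Hence all
    y having some such w below them also form a linked set. Choosing a maximal
    finite antichain of stable elements in each P_n yields countably many
    stable z whose sets of this kind cover P.

    These linked sets are only analytic, but incompatibility is Borel, so two
    applications of Lusin's separation theorem enlarge an analytic linked set
    to a Borel one. *)

Set Implicit Arguments.
Unset Strict Implicit.
Unset Printing Implicit Defensive.

Import Order.TTheory GRing.Theory Num.Theory.

Local Open Scope classical_set_scope.

(** * Borel sets and the Baire space *)

Section borel_sets.
Variable T : topologicalType.

Lemma borel_open (A : set T) : open A -> borel A.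
Proof. exact: sub_sigma_algebra. Qed.

Lemma borel_setC (A : set T) : borel A -> borel (~` A).
Proof.
by have [_ bC _] := @smallest_sigma_algebra T setT open => /bC; rewrite setTD.
Qed.

Lemma borel_set0 : borel (@set0 T).
Proof. by have [] := @smallest_sigma_algebra T setT open. Qed.

Lemma borel_bigcup (F : nat -> set T) :
  (forall n, borel (F n)) -> borel (\bigcup_n F n).
Proof. by have [_ _] := @smallest_sigma_algebra T setT open; apply. Qed.

Lemma borel_bigcap (F : nat -> set T) :
  (forall n, borel (F n)) -> borel (\bigcap_n F n).
Proof.
move=> bF; rewrite -[X in borel X]setCK setC_bigcap.
by apply: borel_setC; apply: borel_bigcup => n; exact: borel_setC.
Qed.

Lemma borel_setI (A B : set T) : borel A -> borel B -> borel (A `&` B).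
Proof.
move=> bA bB; have -> : A `&` B = \bigcap_n (if n is 0%N then A else B).
  apply/seteqP; split=> [x [Ax Bx] [|n]//|x ABx].
  by split; [exact: (ABx 0%N)|exact: (ABx 1%N)].
by apply: borel_bigcap => -[].
Qed.

End borel_sets.

Definition baire : Type := prod_topology (fun _ : nat => nat).
HB.instance Definition _ := Topological.on baire.

Section baire_space.

Definition cylinder (a : baire) (n : nat) : set baire :=
  [set b : baire | forall i, (i < n)%N -> b i = a i].

Lemma cylinder_nbhs (a : baire) n : nbhs a (cylinder a n).
Proof.
elim: n => [|n IH]; first by apply: filterS filterT => b _ i.
have nb : nbhs a [set b : baire | b n = a n].
  apply: (@proj_continuous nat (fun _ => nat) n a [set a n]).
  exact: discrete_set1.
apply: filterS (filterI IH nb) => b [ab abn] i.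
by rewrite ltnS leq_eqVlt => /orP[/eqP->//|/ab].
Qed.

(** The filter generated by the cylinders around [a] converges to [a] in every coordinate, hence in
    the product topology, which is a supremum of initial topologies. *)
Lemma nbhs_cylinder (a : baire) (U : set baire) :
  nbhs a U -> exists n, cylinder a n `<=` U.
Proof.
pose F : set_system baire := [set V | exists n, cylinder a n `<=` V].
have FF : Filter F.
  split; first by exists 0%N.
    move=> V W [n nV] [m mW]; exists (maxn n m) => b ab; split.
      by apply: nV => i ?; apply: ab; rewrite leq_max; apply/orP; left.
    by apply: mW => i ?; apply: ab; rewrite leq_max; apply/orP; right.
  by move=> V W VW [n nV]; exists n; exact: subset_trans VW.
suff : F --> a by exact.
apply/cvg_sup => i V /=.
rewrite (@nbhsE (initial_topology (fun f : forall _ : nat, nat => f i))).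
move=> -[_ [[B _ <-] /= Bai] BV].
by exists i.+1 => b ab; apply: BV; rewrite /= ab.
Qed.

Lemma continuous_to_baire (T : topologicalType) (f : T -> baire) :
  (forall n x, nbhs x [set y | f y n = f x n]) -> continuous f.
Proof.
move=> fc x U /nbhs_cylinder[n nU].
suff : nbhs x [set y | cylinder (f x) n (f y)].
  by apply: filterS => y; exact: nU.
elim: n {nU} => [|n IH]; first by apply: filterS filterT => b _ i.
apply: filterS (filterI IH (fc n x)) => b [ab abn] i.
by rewrite ltnS leq_eqVlt => /orP[/eqP->//|/ab].
Qed.

Definition reindex (g : nat -> nat) (a : baire) : baire := fun n => a (g n).

Lemma continuous_reindex (g : nat -> nat) : continuous (reindex g).
Proof.
apply: continuous_to_baire => n a.
by apply: filterS (cylinder_nbhs a (g n).+1) => b; apply.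
Qed.

End baire_space.

(** * Analytic sets *)

Section suslin_sets.

Lemma closed_preimage_continuous (T U : topologicalType) (f : T -> U) (C : set U) :
  continuous f -> closed C -> closed (f @^-1` C).
Proof. by move=> fc; apply: preimage_closed => x _; exact: fc. Qed.

Lemma continuous_pair (S T U : topologicalType) (f : S -> T) (g : S -> U) :
  continuous f -> continuous g -> continuous (fun x => (f x, g x)).
Proof. by move=> fc gc x; apply: cvg_pair; [exact: fc|exact: gc]. Qed.

Lemma continuous_compose (S T U : topologicalType) (f : S -> T) (g : T -> U) :
  continuous f -> continuous g -> continuous (g \o f).
Proof. by move=> fc gc x; apply: continuous_comp; [exact: fc|exact: gc]. Qed.

Lemma continuous_fst (S T : topologicalType) : continuous (@fst S T).
Proof. by move=> x; exact: cvg_fst. Qed.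

Lemma continuous_snd (S T : topologicalType) : continuous (@snd S T).
Proof. by move=> x; exact: cvg_snd. Qed.

(* Projections of closed sets along the Baire space, i.e. results of the Suslin
   operation on closed sets: closed sets qualify in an arbitrary space [X]. *)
Definition suslin (X : topologicalType) (A : set X) : Prop :=
  exists2 W : set (baire * X), closed W & A = [set x | exists a, W (a, x)].

(** Through the pairing [pickle], one point of the Baire space carries a whole sequence of such
    points, so countably many witnesses merge into one. *)
Definition slice (n : nat) : baire -> baire := reindex (fun m => pickle (n, m)).

Definition interleave (a : nat -> baire) : baire :=
  (* The value 0 at a [k] that codes no pair is never read by any [slice]. *)
  fun k => if @unpickle (nat * nat)%type k is Some (n, m) then a n m else 0%N.

Lemma slice_interleave (a : nat -> baire) n : slice n (interleave a) = a n.
Proof. by apply/funext => m; rewrite /slice /reindex /interleave pickleK. Qed.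

Lemma continuous_slice n : continuous (slice n).
Proof. exact: continuous_reindex. Qed.

Lemma suslin_preimage (X Y : topologicalType) (f : X -> Y) (A : set Y) :
  continuous f -> suslin A -> suslin (f @^-1` A).
Proof.
move=> fc [W cW ->]; exists ((fun p => (p.1, f p.2)) @^-1` W) => //.
apply: closed_preimage_continuous cW; apply: continuous_pair.
  exact: continuous_fst.
exact: continuous_compose (@continuous_snd _ _) fc.
Qed.

Lemma suslin_closed (X : topologicalType) (C : set X) : closed C -> suslin C.
Proof.
move=> cC; exists (snd @^-1` C).
  exact: closed_preimage_continuous (@continuous_snd _ _) cC.
by apply/seteqP; split=> [x Cx|x [a]//]; exists (fun=> 0%N).
Qed.

(** A single code holds a witness for each [F n] in its [n]-th slice, and an intersection of closed
    conditions is closed. *)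
Lemma suslin_bigcap (X : topologicalType) (F : nat -> set X) :
  (forall n, suslin (F n)) -> suslin (\bigcap_n F n).
Proof.
move=> sF; have /choice[W WP] : forall n, exists W : set (baire * X),
    closed W /\ F n = [set x | exists a, W (a, x)].
  by move=> n; have [W] := sF n; exists W.
exists (\bigcap_n ((fun p => (slice n p.1, p.2)) @^-1` W n)).
  apply: closed_bigI => n _; apply: closed_preimage_continuous (WP n).1.
  apply: continuous_pair (@continuous_snd _ _).
  exact: continuous_compose (@continuous_fst _ _) (@continuous_slice n).
apply/seteqP; split=> [x Fx|x [a Wa] n _]; last first.
  by rewrite (WP n).2; exists (slice n a); exact: Wa.
have /choice[a aP] : forall n, exists a, W n (a, x).
  by move=> n; have := Fx n I; rewrite (WP n).2.
by exists (interleave a) => n _; rewrite /= slice_interleave.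
Qed.

(** The first coordinate of the code selects an index [n], and the shifted code is a witness for
    [F n]. *)
Lemma suslin_bigcup (X : topologicalType) (F : nat -> set X) :
  (forall n, suslin (F n)) -> suslin (\bigcup_n F n).
Proof.
move=> sF; have /choice[W WP] : forall n, exists W : set (baire * X),
    closed W /\ F n = [set x | exists a, W (a, x)].
  by move=> n; have [W] := sF n; exists W.
have c0 : continuous (fun p : baire * X => p.1 0%N).
  have p0 : continuous (fun a : baire => a 0%N).
    exact: (@proj_continuous nat (fun=> nat) 0%N).
  exact: continuous_compose (@continuous_fst _ _) p0.
(* The selection is phrased as an intersection of implications [p.1 0 = n -> ...], whose premises
   are clopen, so that the set is visibly closed. *)
exists (\bigcap_n ((fun p => p.1 0%N) @^-1` [set~ n] `|`
    (fun p => (reindex succn p.1, p.2)) @^-1` W n)).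
  apply: closed_bigI => n _; apply: closedU.
    by apply: closed_preimage_continuous c0 _; exact: discrete_closed.
  apply: closed_preimage_continuous (WP n).1.
  apply: continuous_pair (@continuous_snd _ _).
  exact: continuous_compose (@continuous_fst _ _) (@continuous_reindex succn).
apply/seteqP; split=> [x [n _]|x [a Wa]]; last first.
  exists (a 0%N) => //; rewrite (WP _).2; exists (reindex succn a).
  by have [/=|] := Wa (a 0%N) I.
rewrite (WP n).2 => -[a Wa].
exists (fun k => if k is m.+1 then a m else n) => m _ /=.
by have [<-|nm] := eqVneq n m; [right|left; exact/eqP].
Qed.

Lemma suslin_setI (X : topologicalType) (A B : set X) :
  suslin A -> suslin B -> suslin (A `&` B).
Proof.
move=> sA sB; have -> : A `&` B = \bigcap_n (if n is 0%N then A else B).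
  apply/seteqP; split=> [x [Ax Bx] [|n]//|x ABx].
  by split; [exact: (ABx 0%N)|exact: (ABx 1%N)].
by apply: suslin_bigcap => -[].
Qed.

Lemma suslin_baire_proj (X : topologicalType) (A : set (baire * X)) :
  suslin A -> suslin [set x | exists b, A (b, x)].
Proof.
move=> [W cW ->].
exists ((fun p => (slice 0 p.1, (slice 1 p.1, p.2))) @^-1` W).
  apply: closed_preimage_continuous cW; apply: continuous_pair.
    exact: continuous_compose (@continuous_fst _ _) (@continuous_slice 0).
  apply: continuous_pair (@continuous_snd _ _).
  exact: continuous_compose (@continuous_fst _ _) (@continuous_slice 1).
apply/seteqP; split=> [x [b [a Wab]]|x [a Wa]]; last first.
  by exists (slice 1 a), (slice 0 a).
exists (interleave (fun n => if n is 0%N then a else b)).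
by rewrite /= !slice_interleave.
Qed.

Definition opens_are_Fsigma (X : topologicalType) : Prop :=
  forall U : set X, open U ->
  exists2 F : nat -> set X, (forall n, closed (F n)) & U = \bigcup_n F n.

(** The sets that are Suslin together with their complement form a sigma-algebra. It contains the
    open sets because they are countable unions of closed sets. *)
Lemma borel_suslin (X : topologicalType) (A : set X) :
  opens_are_Fsigma X -> borel A -> suslin A.
Proof.
move=> Fs; suff : forall B : set X, borel B -> suslin B /\ suslin (~` B).
  by move=> /[apply] -[].
apply: (@smallest_sub _ _ _ [set B | suslin B /\ suslin (~` B)])
  => [|U oU]; last first.
  split; last by apply: suslin_closed; exact: open_closedC.
  have [F cF ->] := Fs U oU.
  by apply: suslin_bigcup => n; exact: suslin_closed.
split => [|B [sB sCB]|B sB].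
- by rewrite /= setC0; split; apply: suslin_closed; [exact: closed0|exact: closedT].
- by rewrite setTD /= setCK.
- split; first by apply: suslin_bigcup => n; have [] := sB n.
  by rewrite setC_bigcup; apply: suslin_bigcap => n; have [] := sB n.
Qed.

Lemma suslin_cst (X : topologicalType) (Q : Prop) : suslin [set _ : X | Q].
Proof.
have [q|q] := pselect Q; apply: suslin_closed.
  by have -> : [set _ : X | Q] = setT by [apply/seteqP; split]; exact: closedT.
by have -> : [set _ : X | Q] = set0 by [apply/seteqP; split]; exact: closed0.
Qed.

End suslin_sets.

(** * Codes for the points of a Polish space *)

Section polish_spaces.
Variable R : realType.

Lemma natSinv_lt (e : R) : (0 < e)%R ->
  exists N, forall n, (N <= n)%N -> (n.+1%:R^-1 < e)%R.
Proof.
move=> e0; have [N _ NP] := near_infty_natSinv_lt (PosNum e0).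
by exists N.
Qed.

Lemma natSinv_gt0 (n : nat) : (0 < n.+1%:R^-1 :> R)%R.
Proof. by rewrite invr_gt0 ltr0n. Qed.

Lemma pseudometric_opens_are_Fsigma (X : pseudoMetricType R) :
  opens_are_Fsigma X.
Proof.
move=> U oU.
(* Closing up does not leave [U]: a point of the closure is within the radius of some [y] whose ball
   of that same radius lies in [U]. *)
exists (fun n => closure [set x : X | ball x n.+1%:R^-1%R `<=` U]).
  by move=> n; exact: closed_closure.
apply/seteqP; split=> [x Ux|x [n _] /=].
  have /nbhs_ballP[e /= e0 eU] : nbhs x U by exact: open_nbhs_nbhs.
  have [N NP] := natSinv_lt e0.
  exists N => //; apply: subset_closure => y xy; apply: eU.
  exact: le_ball (ltW (NP N (leqnn N))) _ xy.
move=> /(_ _ (nbhsx_ballx x _ (natSinv_gt0 n)))[y [yU xy]].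
by apply: yU; exact: ball_sym.
Qed.

Lemma opens_are_Fsigma_inj (X Y : topologicalType) (f : X -> Y) (g : Y -> X) :
  cancel f g -> continuous f -> continuous g ->
  opens_are_Fsigma Y -> opens_are_Fsigma X.
Proof.
move=> fK fc gc Fs U oU.
have [|F cF UF] := Fs (g @^-1` U); first exact: ((continuousP g).1 gc).
exists (fun n => f @^-1` F n).
  by move=> n; exact: closed_preimage_continuous.
by rewrite -preimage_bigcup -UF -comp_preimage; apply/seteqP; split=> x /=;
  rewrite fK.
Qed.

Section code.
Variables (M : metricType R) (d : nat -> M).

Definition admissible (a : baire) (n : nat) : Prop :=
  forall i j, (i <= j <= n)%N -> ball (d (a i)) i.+1%:R^-1%R (d (a j)).

(* The approximations freeze at the first inadmissible index, so that every
   code yields a Cauchy sequence. *)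
Fixpoint approx (a : baire) (n : nat) : M :=
  if n is m.+1 then if `[< admissible a n >] then d (a n) else approx a m
  else d (a 0%N).

Lemma approx_admissible a n : admissible a n -> approx a n = d (a n).
Proof. by case: n => //= n /asboolP ->. Qed.

(** Valid for every code: admissibility gives the bound up to the freezing index, and the sequence
    is constant afterwards. *)
Lemma approx_ball a i j : (i <= j)%N ->
  ball (approx a i) i.+1%:R^-1%R (approx a j).
Proof.
elim: j => [|j IH] ij.
  by move: ij; rewrite leqn0 => /eqP ->; exact: ballxx.
have [aj|naj] := pselect (admissible a j.+1).
  have ai : admissible a i.
    move=> p q /andP[pq qi]; apply: aj.
    by rewrite pq (leq_trans qi ij).
  by rewrite !approx_admissible//; apply: aj; rewrite ij leqnn.
rewrite /=; case: asboolP => // _.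
move: ij; rewrite leq_eqVlt => /orP[/eqP->|]; last exact: IH.
by rewrite /=; case: asboolP => // _; exact: ballxx.
Qed.

Lemma approx_local a b n :
  (forall i, (i <= n)%N -> a i = b i) -> approx a n = approx b n.
Proof.
have adm c e m : (forall i, (i <= m)%N -> c i = e i) ->
    admissible c m -> admissible e m.
  move=> ce cm i j /[dup] ijm /andP[ij jm].
  by rewrite -!ce//; [exact: cm|exact: leq_trans jm].
elim: n => [ab|n IH ab]; first by rewrite /= ab.
have abn i : (i <= n)%N -> a i = b i by move=> ?; apply: ab; exact: leqW.
rewrite /= (IH abn) ab//; congr (if _ then _ else _).
apply: asbool_equiv_eq; split; apply: adm => // i /ab //.
Qed.

Hypothesis dP : forall (x : M) (e : R), (0 < e)%R -> exists n, ball x e (d n).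
Hypothesis Mc : complete_space M.

Lemma approx_cvg a : exists l : M, approx a @ \oo --> l.
Proof.
apply: Mc; apply/cauchy_ballP => e e0.
have [N NP] := @natSinv_lt (e / 2)%R (divr_gt0 e0 (ltr0n _ 2)).
have tail : \forall n \near \oo, ball (approx a N) (e / 2)%R (approx a n).
  exists N => // n Nn.
  exact: le_ball (ltW (NP N (leqnn N))) _ (approx_ball a Nn).
exists (ball (approx a N) (e / 2)%R, ball (approx a N) (e / 2)%R) => //=.
by move=> [x y] [/= xN yN]; rewrite (splitr e); apply: ball_triangle yN;
  exact: ball_sym.
Qed.

(** A code is sent to the limit of its approximations. Continuity holds because finitely many
    coordinates determine the limit up to a small error. For surjectivity, a fast enough
    approximation of [x] by the dense sequence is an admissible code. *)
Lemma baire_surjection : exists phi : baire -> M,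
  continuous phi /\ forall x, exists a, phi a = x.
Proof.
have /choice[phi phiP] := approx_cvg.
have near_phi a n : ball (approx a n) (n.+1%:R^-1 + n.+1%:R^-1)%R (phi a).
  have /cvg_ballP/(_ _ (natSinv_gt0 n))[j _ jP] := phiP a.
  apply: ball_triangle (approx_ball a (leq_maxl n j)) _.
  by apply: ball_sym; apply: jP; rewrite /= leq_maxr.
exists phi; split=> [a|x].
  apply/cvg_ballP => e e0.
  (* Codes that agree up to [N] share [approx _ N], and each limit is within twice [1/(N+1)] of it:
     four such radii must fit into [e]. *)
  have [N /(_ N (leqnn N)) NP] := @natSinv_lt (e / 4)%R (divr_gt0 e0 (ltr0n _ 4)).
  apply: filterS (cylinder_nbhs a N.+1) => b ab.
  have E : approx a N = approx b N.
    by apply: approx_local => i iN; rewrite ab.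
  have nb := near_phi b N; rewrite -E in nb.
  have := ball_triangle (ball_sym (near_phi a N)) nb.
  apply: le_ball; apply: ltW; move: NP; set r : R := (N.+1%:R^-1)%R.
  by move=> NP; lra.
(* Half the radius, so that the triangle inequality through [x] keeps terms [i <= j] within
   [1/(i+1)] of each other. *)
have half n : (0 < n.+1%:R^-1 / 2 :> R)%R by rewrite divr_gt0 ?natSinv_gt0.
have /choice[a aP] := fun n => dP x (half n).
exists a; have adm n : admissible a n.
  move=> i j /andP[ij _].
  rewrite (splitr (i.+1%:R^-1)%R); apply: ball_triangle (ball_sym (aP i)) _.
  apply: le_ball _ _ (aP j).
  by rewrite ler_pM2r ?invr_gt0// lef_pV2 ?posrE ?ltr0n// ler_nat ltnS.
apply: (cvg_unique _ (phiP a)); first exact: metric_hausdorff.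
apply/cvg_ballP => e e0; have [N NP] := natSinv_lt e0.
exists N => // n Nn; rewrite approx_admissible//.
apply: le_ball _ _ (aP n).
by have := NP n Nn; have := natSinv_gt0 n; set r : R := (n.+1%:R^-1)%R; lra.
Qed.

End code.
End polish_spaces.

(** * Separation of analytic sets *)

Section separation.
Variable T : topologicalType.

Definition borel_separated (A B : set T) : Prop :=
  exists C : set T, [/\ borel C, A `<=` C & C `<=` ~` B].

(** Read contrapositively below: if two countable unions are not separated, neither is some pair of
    their members. *)
Lemma borel_separated_bigcup (A B : nat -> set T) :
  (forall m n, borel_separated (A m) (B n)) ->
  borel_separated (\bigcup_m A m) (\bigcup_n B n).
Proof.
move=> sAB; have /choice[C CP] : forall p : nat * nat, exists C : set T,
    [/\ borel C, A p.1 `<=` C & C `<=` ~` B p.2] by move=> [m n]; exact: sAB.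
exists (\bigcup_m \bigcap_n C (m, n)); split.
- apply: borel_bigcup => m; apply: borel_bigcap => n.
  by have [] := CP (m, n).
- move=> x [m _ Ax]; exists m => // n _.
  by have [_ + _] := CP (m, n); exact.
- move=> x [m _ Cx] [n _ Bx].
  by have [_ _ /(_ x (Cx n I))] := CP (m, n).
Qed.

Section cylinder_images.
Variables (f : baire -> T) (C : set baire).

Definition image_piece (a : baire) (n : nat) : set T := f @` (C `&` cylinder a n).

Definition set_coord (a : baire) (n m : nat) : baire :=
  fun i => if i == n then m else a i.

Lemma image_piece_split a n :
  image_piece a n = \bigcup_m image_piece (set_coord a n m) n.+1.
Proof.
apply/seteqP; split=> [_ [b [Cb ab] <-]|_ [m _ [b [Cb ab] <-]]].
  exists (b n) => //; exists b => //; split=> // i.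
  rewrite /set_coord; have [->//|ni] := eqVneq i n.
  by rewrite ltnS leq_eqVlt (negbTE ni) => /ab.
exists b => //; split=> // i ni.
by rewrite ab ?leqW// /set_coord ltn_eqF.
Qed.

Lemma image_piece_cylinder a b n :
  cylinder a n b -> image_piece b n = image_piece a n.
Proof.
move=> ab; suff E : cylinder b n = cylinder a n by rewrite /image_piece E.
by apply/seteqP; split=> c h i ni; rewrite h// ab.
Qed.

Lemma image_piece_subset (a : baire) (U : set baire) :
  nbhs a U -> exists N, forall n, (N <= n)%N -> image_piece a n `<=` f @` (C `&` U).
Proof.
move=> /nbhs_cylinder[N NU]; exists N => n Nn _ [b [Cb ab] <-].
by exists b => //; split=> //; apply: NU => i iN; apply: ab; exact: leq_trans Nn.
Qed.

End cylinder_images.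

(** Lusin's argument. If the images are not separated, one can refine cylinders of codes forever
    while the images of their traces on [C] and [D] stay unseparated. The limits [a] and [b] lie in
    [C] and [D], so [f a] and [g b] differ; disjoint open sets around them separate the images of
    small enough cylinders. *)
Lemma image_separation (f g : baire -> T) (C D : set baire) :
  hausdorff_space T -> continuous f -> continuous g -> closed C -> closed D ->
  (f @` C) `&` (g @` D) = set0 -> borel_separated (f @` C) (g @` D).
Proof.
move=> hT fc gc cC cD CD0; apply: contrapT => nsep.
pose bad (p : baire * baire * nat) := ~ borel_separated
  (image_piece f C p.1.1 p.2) (image_piece g D p.1.2 p.2).
(* Conditional on [bad p], so that every state has a successor, as dependent choice requires. *)
pose succ (p q : baire * baire * nat) := bad p ->
  [/\ bad q, q.2 = p.2.+1, cylinder p.1.1 p.2 q.1.1 & cylinder p.1.2 p.2 q.1.2].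
have cyl a n m : cylinder a n (set_coord a n m).
  by move=> i ni; rewrite /set_coord ltn_eqF.
have step p : {q | succ p q}.
  apply/cid; have [bp|] := pselect (bad p); last by exists p.
  suff [[m n] mnP] : exists mn : nat * nat,
      bad (set_coord p.1.1 p.2 mn.1, set_coord p.1.2 p.2 mn.2, p.2.+1).
    exists (set_coord p.1.1 p.2 m, set_coord p.1.2 p.2 n, p.2.+1) => _.
    by split=> //=; exact: cyl.
  apply: contrapT => nmn; apply: bp.
  rewrite (image_piece_split f C p.1.1) (image_piece_split g D p.1.2).
  apply: borel_separated_bigcup => m n; apply: contrapT => mn.
  by apply: nmn; exists (m, n).
have [s [s0 sS]] := dependent_choice step ((fun=> 0%N), (fun=> 0%N), 0%N).
have sP n : bad (s n) /\ (s n).2 = n.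
  elim: n => [|n [bn sn]]; last by have [? + _ _] := sS n bn; rewrite sn.
  rewrite s0; split=> //; rewrite /bad /=.
  suff E h E : image_piece h E (fun=> 0%N) 0 = h @` E by rewrite !E.
  by apply/seteqP; split=> _ [b bE <-]; exists b => //; case: bE.
have sC n m : (n <= m)%N ->
    cylinder (s n).1.1 n (s m).1.1 /\ cylinder (s n).1.2 n (s m).1.2.
  elim: m => [|m IH]; first by rewrite leqn0 => /eqP ->; split.
  rewrite leq_eqVlt => /orP[/eqP ->|]; first by split.
  rewrite ltnS => nm; have [sn1 sn2] := IH nm.
  have [bm sm] := sP m; have [_ _ m1 m2] := sS m bm.
  rewrite sm in m1 m2.
  by split=> i ni; [rewrite m1 ?sn1|rewrite m2 ?sn2] => //; exact: leq_trans nm.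
(* Coordinate [i] no longer changes from stage [i+1] on. *)
pose a : baire := fun i => (s i.+1).1.1 i.
pose b : baire := fun i => (s i.+1).1.2 i.
have bad_ab n : ~ borel_separated (image_piece f C a n) (image_piece g D b n).
  have [+ sn] := sP n; rewrite /bad sn.
  have an : cylinder a n (s n).1.1.
    by move=> i ni; rewrite /a; have [->] := sC _ _ ni.
  have bn : cylinder b n (s n).1.2.
    by move=> i ni; rewrite /b; have [_ ->] := sC _ _ ni.
  by rewrite (image_piece_cylinder f C an) (image_piece_cylinder g D bn).
(* Otherwise a small cylinder around [a] misses the closed set [C], its piece is empty, and [set0]
   separates; for [b] and [D] the separator is [setT]. *)
have Ca : C a.
  apply: contrapT => nCa; have : nbhs a (~` C).
    by apply: open_nbhs_nbhs; split=> //; exact: closed_openC.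
  move=> /(image_piece_subset f C)[n /(_ n (leqnn n)) nP]; apply: (bad_ab n).
  exists set0; split=> //; first exact: borel_set0.
  by move=> x /nP[y [Cy /(_ Cy)]].
have Db : D b.
  apply: contrapT => nDb; have : nbhs b (~` D).
    by apply: open_nbhs_nbhs; split=> //; exact: closed_openC.
  move=> /(image_piece_subset g D)[n /(_ n (leqnn n)) nP]; apply: (bad_ab n).
  exists setT; split=> //; first by rewrite -setC0;
    apply: borel_setC; exact: borel_set0.
  by move=> x _ /nP[y [Dy /(_ Dy)]].
have fg : f a != g b.
  apply/eqP => fagb; suff : set0 (f a) by [].
  by rewrite -CD0; split; [exists a|rewrite fagb; exists b].
move: hT; rewrite open_hausdorff => /(_ _ _ fg)[[U V]] /=.
rewrite !inE => -[Ufa Vgb] [oU oV UV0].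
have /(image_piece_subset f C)[n nP] : nbhs a (f @^-1` U).
  by apply: fc; exact: open_nbhs_nbhs.
have /(image_piece_subset g D)[m mP] : nbhs b (g @^-1` V).
  by apply: gc; exact: open_nbhs_nbhs.
apply: (bad_ab (maxn n m)); exists U; split; first exact: borel_open.
  by move=> x /(nP _ (leq_maxl _ _))[y [_ Uy] <-].
move=> x Ux /(mP _ (leq_maxr _ _))[y [_ Vy] yx].
suff : set0 x by [].
by rewrite -UV0; split=> //; rewrite -yx.
Qed.

Variable phi : baire -> T.
Hypotheses (phi_continuous : continuous phi)
  (phi_surjective : forall x, exists a, phi a = x).

(** Slice 0 of a code holds the witness and slice 1 a [phi]-name of the point, which turns a
    projection into a continuous image of a closed set of codes. *)
Lemma suslin_image (A : set T) : suslin A ->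
  exists (f : baire -> T) (C : set baire), [/\ continuous f, closed C & A = f @` C].
Proof.
move=> [W cW ->]; exists (phi \o slice 1).
have c1 : continuous (phi \o slice 1).
  exact: continuous_compose (@continuous_slice 1) phi_continuous.
exists ((fun a => (slice 0 a, (phi \o slice 1) a)) @^-1` W); split=> //.
  apply: closed_preimage_continuous cW.
  exact: continuous_pair (@continuous_slice 0) c1.
apply/seteqP; split=> [x [a Wax]|_ [a Wa <-]]; last by exists (slice 0 a).
have [b bx] := phi_surjective x.
by exists (interleave (fun n => if n is 0%N then a else b));
  rewrite /= !slice_interleave bx.
Qed.

Lemma suslin_separation (A B : set T) : hausdorff_space T ->
  suslin A -> suslin B -> A `&` B = set0 -> borel_separated A B.
Proof.
move=> hT /suslin_image[f [C [fc cC ->]]] /suslin_image[g [D [gc cD ->]]].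
exact: image_separation.
Qed.

Lemma suslin_proj (X : topologicalType) (A : set (T * X)) :
  suslin A -> suslin [set x | exists y, A (y, x)].
Proof.
move=> sA; have -> : [set x | exists y, A (y, x)] =
    [set x | exists b, ((fun p => (phi p.1, p.2)) @^-1` A) (b, x)].
  apply/seteqP; split=> [x [y Axy]|x [b Abx]]; last by exists (phi b).
  by have [b yb] := phi_surjective y; exists b; rewrite /= yb.
apply: suslin_baire_proj; apply: suslin_preimage sA.
apply: continuous_pair (@continuous_snd _ _).
exact: continuous_compose (@continuous_fst _ _) phi_continuous.
Qed.

(* First separate [A] from the points related to a point of [A], then from the
   points related to a point of the Borel set [B] so obtained. *)
Lemma suslin_unrelated_borel (A : set T) (r : set (T * T)) :
  hausdorff_space T -> suslin r -> (forall x y, r (x, y) -> r (y, x)) ->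
  suslin A -> (forall x y, A x -> A y -> ~ r (x, y)) ->
  (forall B : set T, borel B -> suslin B) ->
  exists B : set T, [/\ borel B, A `<=` B & forall x y, B x -> B y -> ~ r (x, y)].
Proof.
move=> hT sr rsym sA Ar bs.
have related_suslin B : suslin B ->
    suslin [set y | exists x, (r `&` fst @^-1` B) (x, y)].
  move=> sB; apply: suslin_proj; apply: suslin_setI => //.
  exact: suslin_preimage (@continuous_fst _ _) sB.
have [|B [bB AB Br]] := suslin_separation hT sA (related_suslin _ sA).
  apply/seteqP; split=> // y [Ay [x [/= rxy Ax]]]; exact: Ar rxy.
have [|B' [bB' AB' Br']] := suslin_separation hT sA (related_suslin _ (bs _ bB)).
  apply/seteqP; split=> // y [Ay [x [/= rxy Bx]]].
  by apply: (Br x Bx); exists y; split=> //; exact: rsym.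
exists (B `&` B'); split; first exact: borel_setI.
  by move=> x Ax; split; [exact: AB|exact: AB'].
by move=> x y [Bx _] [_ B'y] rxy; apply: (Br' y B'y); exists x.
Qed.

End separation.

(** * Antichains below an element *)

Section antichains.
Variables (d : Order.disp_t) (P : porderType d).
Implicit Types (S : set P) (x y z w : P) (a : nat -> P).

Lemma compatible_sym x y : compatible x y -> compatible y x.
Proof. by move=> [z [zx zy]]; exists z. Qed.

Lemma compatible_le x y x' y' :
  (x' <= x)%O -> (y' <= y)%O -> compatible x' y' -> compatible x y.
Proof.
by move=> xx yy [z [zx zy]]; exists z; rewrite (le_trans zx)// (le_trans zy).
Qed.

Lemma compatible_refl x : compatible x x.
Proof. by exists x. Qed.

(** A finite antichain enumerated by the first [j] values of [a]. The enumeration is automatically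
    injective, since every element is compatible with itself. *)
Definition incompatible_family S (j : nat) a : Prop :=
  (forall i, (i < j)%N -> S (a i)) /\
  (forall i i', (i < j)%N -> (i' < j)%N -> i <> i' -> incompatible (a i) (a i')).

Lemma incompatible_family_subset S S' j a :
  S `<=` S' -> incompatible_family S j a -> incompatible_family S' j a.
Proof. by move=> SS' [aS ainc]; split=> // i /aS /SS'. Qed.

Lemma incompatible_family1 S z : S z -> incompatible_family S 1 (fun=> z).
Proof.
move=> Sz; split=> // i i'; rewrite !ltnS !leqn0 => /eqP -> /eqP ->.
by move=> /(_ erefl).
Qed.

Lemma incompatible_family_cat S j j' a a' :
  incompatible_family S j a -> incompatible_family S j' a' ->
  (forall i i', (i < j)%N -> (i' < j')%N -> incompatible (a i) (a' i')) ->
  incompatible_family S (j + j')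
    (fun i => if (i < j)%N then a i else a' (i - j)%N).
Proof.
move=> [aS ai] [a'S a'i] aa'.
have sub i : (i < j + j')%N -> (i < j)%N = false -> (i - j < j')%N.
  by move=> ij /negbT; rewrite -leqNgt => ji; rewrite ltn_subLR.
split=> [i ij|i i' ij i'j ii'].
  by case: ifPn => [/aS//|/negbTE nij]; apply: a'S; exact: sub.
case: ifPn => [li|/negbTE nij]; case: ifPn => [li'|/negbTE nij'].
- exact: ai.
- by apply: aa' => //; exact: sub.
- by move=> /compatible_sym; apply: aa' => //; exact: sub.
- apply: a'i; [exact: sub|exact: sub|move=> e; apply: ii'].
  rewrite -(@subnK j i) 1?leqNgt ?nij// e subnK// leqNgt.
  by rewrite nij'.
Qed.

Lemma incompatible_family_bound S k j a :
  (forall A : set P, A `<=` S -> antichain A -> card_less A k) ->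
  incompatible_family S j a -> (j < k)%N.
Proof.
move=> Sk [aS ai]; have [|x y|m mk am] := Sk (a @` `I_j).
- by move=> _ [i ij <-]; exact: aS.
- by move=> [i ij <-] [i' ij' <-] xy; apply: ai => // ii'; rewrite ii' in xy.
have aj : (a @` `I_j #= `I_j)%card.
  apply: inj_card_eq => i i'; rewrite !inE => ij ij' aii'.
  apply: contrapT => /(ai _ _ ij ij'); rewrite aii'.
  by apply; exact: compatible_refl.
have /card_eq_II <- // : (`I_m #= `I_j)%card.
by apply: card_eq_trans aj; rewrite card_eq_sym.
Qed.

(** A family of greatest length works, since an element incompatible with all its members could be
    appended. *)
Lemma maximal_incompatible_family S k (x0 : P) :
  (forall j a, incompatible_family S j a -> (j < k)%N) ->
  exists j a, incompatible_family S j a /\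
    forall z, S z -> exists2 i, (i < j)%N & compatible z (a i).
Proof.
move=> Sk; pose p j := `[< exists a, incompatible_family S j a >].
have p0 : exists j, p j by exists 0%N; apply/asboolP; exists (fun=> x0).
have pk j : p j -> (j <= k)%N by move=> /asboolP[a /Sk /ltnW].
have [j /asboolP[a aj] jmax] := ex_maxnP p0 pk.
exists j, a; split=> // z Sz; apply: contrapT => nz.
suff : (j + 1 <= j)%N by rewrite addn1 ltnn.
apply: jmax; apply/asboolP.
exists (fun i => if (i < j)%N then a i else z).
apply: (@incompatible_family_cat S j 1 a (fun=> z)) => //.
  exact: incompatible_family1.
by move=> i i' ij _ /compatible_sym zai; apply: nz; exists i.
Qed.

(** For [S] the [n]-th piece this says m_n(z) >= j, without having to define the maximum. *)
Definition spread S (j : nat) z : Prop :=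
  exists a, incompatible_family (S `&` [set x | (x <= z)%O]) j a.

Lemma spread_leq S j j' z : (j <= j')%N -> spread S j' z -> spread S j z.
Proof.
move=> jj [a [aS ai]]; exists a; split=> [i ij|i i' ij ij'].
  by apply: aS; exact: leq_trans jj.
by apply: ai; exact: leq_trans jj.
Qed.

Lemma spread_add S j j' z w w' : (w <= z)%O -> (w' <= z)%O ->
  incompatible w w' -> spread S j w -> spread S j' w' -> spread S (j + j') z.
Proof.
move=> wz w'z ww' [a aw] [a' aw'].
exists (fun i => if (i < j)%N then a i else a' (i - j)%N).
apply: incompatible_family_cat.
- by apply: incompatible_family_subset aw => x [Sx xw]; split=> //=;
  exact: le_trans wz.
- by apply: incompatible_family_subset aw' => x [Sx xw]; split=> //=;
  exact: le_trans w'z.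
- move=> i i' ij ij' c; apply: ww'; apply: compatible_le c.
    by have [] := aw.1 i ij.
  by have [] := aw'.1 i' ij'.
Qed.

Lemma spread1 S z : S z -> spread S 1 z.
Proof. by move=> Sz; exists (fun=> z); apply: incompatible_family1; split=> /=. Qed.

(** * Stable elements and the linked sets they generate *)

Section uniform_bound.
Variables (k : nat) (D : set nat) (Q : nat -> set P).
Hypothesis Q_cover : forall z, exists2 n, D n & Q n z.
Hypothesis Q_bound : forall n, D n ->
  forall A : set P, A `<=` Q n -> antichain A -> card_less A k.

(* [j] is the largest size of an antichain of a single piece below [z], and
   stays so below every [w <= z]. *)
Definition stable (j : nat) z : Prop :=
  (forall w, (w <= z)%O -> exists2 n, D n & spread (Q n) j w) /\
  (forall n, D n -> ~ spread (Q n) j.+1 z).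

Lemma stable_gt0 j z : stable j z -> (0 < j)%N.
Proof.
case: j => // -[_ nz]; have [n Dn Qz] := Q_cover z.
by exfalso; apply: (nz n Dn); exact: spread1.
Qed.

(** Take the least number that bounds strictly the antichains of all pieces below some [w <= z]; the
    bound [k] provides such a number. By minimality its predecessor is attained below every
    [v <= w]. *)
Lemma stable_dense z : exists2 w, (w <= z)%O & exists j, stable j w.
Proof.
pose p j := `[< exists2 w, (w <= z)%O & forall n, D n -> ~ spread (Q n) j w >].
have p0 : exists j, p j.
  exists k; apply/asboolP; exists z => // n Dn [a az].
  suff : (k < k)%N by rewrite ltnn.
  apply: (@incompatible_family_bound (Q n) k k a (Q_bound Dn)).
  by apply: incompatible_family_subset az => x [].
(* The least number is not 0, since the empty family always exists; it is therefore the successor of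
   the required [j]. *)
have [[|j] /asboolP[w wz nw] jmin] := ex_minnP p0.
  have [n Dn _] := Q_cover w.
  by case: (nw n Dn); exists (fun=> w); split.
exists w => //; exists j; split=> // v vw; apply: contrapT => nv.
suff : (j.+1 <= j)%N by rewrite ltnn.
apply: jmin; apply/asboolP; exists v; first exact: le_trans wz.
by move=> n Dn sv; apply: nv; exists n.
Qed.

Lemma stable_linked j z n : stable j z -> D n ->
  linked [set w | (w <= z)%O /\ spread (Q n) j w].
Proof.
move=> sz Dn w w' [wz sw] [wz' sw']; apply: contrapT => ww'.
(* Here j + 1 <= j + j, because [j] is positive. *)
apply: (sz.2 n Dn); apply: (@spread_leq _ _ (j + j)).
  by rewrite -addn1 leq_add2l (stable_gt0 sz).
exact: spread_add ww' sw sw'.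
Qed.

Definition shadow j z n : set P :=
  [set y | exists w, [/\ (w <= z)%O, (w <= y)%O & spread (Q n) j w]].

Lemma shadow_linked j z n : stable j z -> D n -> linked (shadow j z n).
Proof.
move=> sz Dn y y' [w [wz wy sw]] [w' [w'z w'y' sw']].
by apply: (compatible_le wy w'y'); apply: (stable_linked sz Dn).
Qed.

(** In each piece, [s m] enumerates a maximal antichain of stable elements. Below [y] there is a
    stable [z]; in its piece it meets some [s m i], and a common lower bound [w] places [y] in a
    shadow of [s m i]. *)
Lemma shadow_cover (x0 : P) : exists s : nat -> nat -> P, forall y,
  exists m i j n, [/\ stable j (s m i), D n & shadow j (s m i) n y].
Proof.
pose S m := [set z | [/\ D m, Q m z & exists j, stable j z]].
have /choice[s sP] : forall m, exists s : nat -> P, forall z, S m z ->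
    exists i, S m (s i) /\ compatible z (s i).
  move=> m; have [Dm|nDm] := pselect (D m); last first.
    by exists (fun=> x0) => z [].
  have [|l [s [sS smax]]] := @maximal_incompatible_family (S m) k x0.
    move=> l s sl; apply: (incompatible_family_bound (Q_bound Dm)).
    by apply: incompatible_family_subset sl => z [].
  by exists s => z /smax[i il zi]; exists i; split=> //; exact: sS.1.
exists s => y; have [z zy [jz sz]] := stable_dense y.
have [m Dm Qz] := Q_cover z.
have [|i [[_ _ [j sj]] [w [wz wi]]]] := sP m z; first by split=> //; exists jz.
(* The stability used is that of [s m i], with its own [j]; the one of [z] only served to put [z]
   into [S m]. *)
have [n Dn sw] := sj.1 w wi.
exists m, i, j, n; split=> //; exists w; split=> //.
exact: le_trans zy.
Qed.

End uniform_bound.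
End antichains.

(** * Definability of the linked pieces *)

Section polish_consequences.
Variables (R : realType) (T : topologicalType).
Hypothesis T_polish : polish R T.

Lemma polish_hausdorff : hausdorff_space T.
Proof.
have [_ [M [f [[g [fK gK fc gc]] _]]]] := T_polish.
move=> p q pq; rewrite -(fK p) -(fK q); congr g.
apply: metric_hausdorff => A B Ap Bq.
by have [x [Ax Bx]] := pq _ _ (fc _ _ Ap) (fc _ _ Bq); exists (f x).
Qed.

Lemma polish_opens_are_Fsigma : opens_are_Fsigma T.
Proof.
have [_ [M [f [[g [fK gK fc gc]] _]]]] := T_polish.
exact: opens_are_Fsigma_inj fK fc gc (@pseudometric_opens_are_Fsigma R M).
Qed.

Lemma polish_square_opens_are_Fsigma : opens_are_Fsigma (T * T)%type.
Proof.
have [_ [M [f [[g [fK gK fc gc]] _]]]] := T_polish.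
have c2 (X Y : topologicalType) (h : X -> Y) : continuous h ->
    continuous (fun p : X * X => (h p.1, h p.2)).
  move=> hc; apply: continuous_pair.
    exact: continuous_compose (@continuous_fst _ _) hc.
  exact: continuous_compose (@continuous_snd _ _) hc.
apply: (opens_are_Fsigma_inj _ (c2 _ _ _ fc) (c2 _ _ _ gc)
  (@pseudometric_opens_are_Fsigma R (M * M)%type)).
by move=> [x y] /=; rewrite !fK.
Qed.

(** A countable dense set is enumerated and its image in the complete metric model [M] feeds
    [baire_surjection]; [x0] fills the indices that enumerate nothing. *)
Lemma polish_baire_surjection (x0 : T) : exists phi : baire -> T,
  continuous phi /\ forall x, exists a, phi a = x.
Proof.
have [[S /countable_injP[c cS] Sd] [M [f [[g [fK gK fc gc]] Mc]]]] := T_polish.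
have /choice[e eP] : forall n, exists x,
    (exists2 y, S y & c y = n) -> S x /\ c x = n.
  move=> n; have [[y Sy cy]|nS] := pselect (exists2 y, S y & c y = n).
    by exists y.
  by exists x0.
have eS x : S x -> e (c x) = x.
  move=> Sx; have [|Se ce] := eP (c x); first by exists x.
  by apply: cS => //; rewrite inE.
have dense_seq (x : M) (r : R) : (0 < r)%R -> exists n, ball x r (f (e n)).
  move=> r0; have [||y [By Sy]] := Sd (f @^-1` (ball x r)°).
  - by exists (g x); rewrite /= gK; exact: nbhsx_ballx.
  - by apply: (continuousP _).1 => //; exact: open_interior.
  - by exists (c y); rewrite eS//; exact: interior_subset.
have [phi [pc ps]] := baire_surjection dense_seq Mc.
exists (g \o phi); split; first exact: continuous_compose pc gc.
by move=> x; have [a ax] := ps (f x); exists a; rewrite /= ax fK.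
Qed.

End polish_consequences.

(** The premise does not depend on the point. This lets conditions on indices below [j] become
    intersections over all naturals. *)
Lemma suslin_imply (X : topologicalType) (H : Prop) (A : set X) :
  suslin A -> suslin [set x | H -> A x].
Proof.
move=> sA; have [h|nh] := pselect H.
  by have -> : [set x | H -> A x] = A by apply/seteqP; split=> [x /(_ h)|x Ax].
have -> : [set x | H -> A x] = [set _ | True].
  by apply/seteqP; split=> // x _ /nh.
exact: suslin_cst.
Qed.

Lemma borel_sigma_linked_cover (d : Order.disp_t) (P : POrderedTopological.type d)
    (F : nat -> set P) :
  (forall n, borel (F n)) -> (forall n, linked (F n)) ->
  (forall x, exists n, F n x) -> borel_sigma_linked P.
Proof.
(* Disjointification may produce empty pieces, which a partition forbids; the index set discards
   them. *)
move=> bF lF cF; exists [set n | seqDU F n !=set0], (seqDU F).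
split; last first.
  by move=> n _ x y Fx Fy; apply: (lF n); exact: subset_seqDU.
split; last first.
  move=> n _; rewrite /seqDU setDE -bigcup_mkord; apply: borel_setI => //.
  apply: borel_setC; rewrite bigcup_mkcond; apply: borel_bigcup => m.
  by case: ifP => // _; exact: borel_set0.
split=> //; last first.
  by apply: sub_trivIset (trivIset_seqDU F).
apply/seteqP; split=> // x _; have [n Fx] := cF x.
have : (\bigcup_k seqDU F k) x by rewrite -seqDU_bigcup_eq; exists n.
by move=> [m _ Fmx]; exists m => //; exists x.
Qed.

Section definability.
Variables (R : realType) (d : Order.disp_t) (P : POrderedTopological.type d).
Variable phi : baire -> P.
Hypotheses (phi_continuous : continuous phi)
  (phi_surjective : forall x, exists a, phi a = x)
  (le_suslin : suslin [set p : (P * P)%type | (p.1 <= p.2)%O])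
  (incompatible_suslin : suslin [set p : (P * P)%type | incompatible p.1 p.2]).

(** The whole family is coded by one point of the Baire space, its [i]-th member being named by the
    [i]-th slice; what remains is a countable intersection of Suslin conditions. *)
Lemma spread_suslin (S : set P) j : suslin S -> suslin [set z | spread S j z].
Proof.
move=> sS.
have pc i : continuous (fun p : (baire * P)%type => phi (slice i p.1)).
  apply: (continuous_compose _ phi_continuous (f := slice i \o fst)).
  exact: continuous_compose (@continuous_fst _ _) (@continuous_slice i).
have -> : [set z | spread S j z] = [set z | exists b,
    ([set p : (baire * P)%type | forall i, (i < j)%N ->
        S (phi (slice i p.1)) /\ (phi (slice i p.1) <= p.2)%O] `&`
     [set p : (baire * P)%type | forall i i', (i < j)%N -> (i' < j)%N ->
        i <> i' -> incompatible (phi (slice i p.1)) (phi (slice i' p.1))]) (b, z)].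
  apply/seteqP; split=> z [a aP]; last by exists (fun i => phi (slice i a)).
  have /choice[b bP] := fun i => phi_surjective (a i).
  exists (interleave b) => /=.
  have E i : phi (slice i (interleave b)) = a i by rewrite slice_interleave bP.
  by split=> [i ij|i i' ij ij']; rewrite !E; [exact: aP.1|exact: aP.2].
apply: suslin_baire_proj; apply: suslin_setI.
  have -> : [set p : (baire * P)%type | forall i, (i < j)%N ->
      S (phi (slice i p.1)) /\ (phi (slice i p.1) <= p.2)%O] =
    \bigcap_i [set p | (i < j)%N -> ((fun p => phi (slice i p.1)) @^-1` S `&`
      (fun p => (phi (slice i p.1), p.2)) @^-1`
        [set p : (P * P)%type | (p.1 <= p.2)%O]) p].
    by apply/seteqP; split=> p pP; [move=> i _; exact: pP|move=> i; exact: pP].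
  apply: suslin_bigcap => i; apply: suslin_imply; apply: suslin_setI.
    exact: suslin_preimage (pc i) sS.
  by apply: suslin_preimage le_suslin; apply: continuous_pair (@continuous_snd _ _).
have -> : [set p : (baire * P)%type | forall i i', (i < j)%N -> (i' < j)%N ->
    i <> i' -> incompatible (phi (slice i p.1)) (phi (slice i' p.1))] =
  \bigcap_i \bigcap_i' [set p | [/\ (i < j)%N, (i' < j)%N & i <> i'] ->
    ((fun p => (phi (slice i p.1), phi (slice i' p.1))) @^-1`
      [set p : (P * P)%type | incompatible p.1 p.2]) p].
  apply/seteqP; split=> p pP.
    by move=> i _ i' _ [ij ij' ii']; exact: pP.
  by move=> i i' ij ij' ii'; exact: (pP i I i' I).
apply: suslin_bigcap => i; apply: suslin_bigcap => i'; apply: suslin_imply.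
by apply: suslin_preimage incompatible_suslin; exact: continuous_pair.
Qed.

Lemma shadow_suslin (Q : nat -> set P) j z n :
  suslin (Q n) -> suslin (shadow Q j z n).
Proof.
move=> sQ; have -> : shadow Q j z n = [set y | exists w,
    ((fun p : (P * P)%type => (p.1, z)) @^-1` [set p | (p.1 <= p.2)%O] `&`
     ([set p | (p.1 <= p.2)%O] `&` fst @^-1` [set w | spread (Q n) j w])) (w, y)].
  by apply/seteqP; split=> y [w]; [case=> ? ? ?|case=> ? [? ?]]; exists w.
apply: (suslin_proj phi_continuous phi_surjective).
apply: suslin_setI.
  apply: suslin_preimage le_suslin; apply: continuous_pair (@continuous_fst _ _) _.
  by move=> x; exact: cvg_cst.
apply: suslin_setI => //.
by apply: suslin_preimage (@continuous_fst _ _) _; exact: spread_suslin.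
Qed.

End definability.

Theorem theorem6 (R : realType) (d : Order.disp_t)
    (P : POrderedTopological.type d)
    (hP : borel_poset R P)
    (hinc : borel [set xy : (P * P)%type | incompatible xy.1 xy.2])
    (k : nat) (D : set nat) (Q : nat -> set P)
    (hQ : countable_borel_partition D Q)
    (hk : forall n : nat, D n ->
          forall A : set P, A `<=` Q n -> antichain A -> card_less A k) :
  borel_sigma_linked P.
Proof.
have [Pp le_borel] := hP; have [[Qc _ _] Qb] := hQ.
(* An empty [P] is treated apart, as it is not an image of the Baire space. *)
have [[x0 _]|P0] := pselect (exists x : P, True); last first.
  apply: (@borel_sigma_linked_cover _ _ (fun=> set0)) => [_|_ x y []|x].
    exact: borel_set0.
  by case: P0; exists x.
have Q_cover z : exists2 n, D n & Q n z.
  by have : [set: P] z by []; rewrite -Qc => -[n Dn Qz]; exists n.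
have [phi [pc ps]] := polish_baire_surjection Pp x0.
have bs2 := fun A => @borel_suslin _ A (polish_square_opens_are_Fsigma Pp).
have bs := fun A => @borel_suslin _ A (polish_opens_are_Fsigma Pp).
have [s sP] := shadow_cover Q_cover hk x0.
(* A code is a quadruple (m, i, j, n). Stability is part of membership, so that [F c] is empty for a
   code without linked shadow guaranteed. *)
pose F (c : nat * nat * nat * nat) : set P := [set y |
  [/\ stable D Q c.1.2 (s c.1.1.1 c.1.1.2), D c.2
    & shadow Q c.1.2 (s c.1.1.1 c.1.1.2) c.2 y]].
have /choice[G GP] : forall c, exists B : set P, [/\ borel B, F c `<=` B & linked B].
  move=> c; have [[sc Dc]|nc] := pselect
      (stable D Q c.1.2 (s c.1.1.1 c.1.1.2) /\ D c.2); last first.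
    by exists set0; split=> [|y [? ? _]|//]; [exact: borel_set0|case: nc].
  have s_shadow : suslin (shadow Q c.1.2 (s c.1.1.1 c.1.1.2) c.2).
    apply: (shadow_suslin pc ps); [exact: bs2|exact: bs2|].
    by apply: bs; exact: Qb.
  have inc_sym (x y : P) : incompatible x y -> incompatible y x.
    by move=> xy /compatible_sym.
  have compat x y : shadow Q c.1.2 (s c.1.1.1 c.1.1.2) c.2 x ->
      shadow Q c.1.2 (s c.1.1.1 c.1.1.2) c.2 y -> ~ incompatible x y.
    by move=> xF yF; apply; exact: (shadow_linked Q_cover sc Dc).
  have [B [bB FB lB]] := suslin_unrelated_borel pc ps (polish_hausdorff Pp)
    (bs2 _ hinc) inc_sym s_shadow compat bs.
  exists B; split=> // [y [_ _ /FB]//|x y Bx By].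
  by apply: contrapT => nc; exact: (lB x y).
apply: (@borel_sigma_linked_cover _ _
  (fun n => if unpickle n is Some c then G c else set0)).
- by move=> n; case: unpickle => [c|]; [case: (GP c)|exact: borel_set0].
- by move=> n; case: unpickle => [c|//]; case: (GP c).
- move=> x; have [m [i [j [n [sj Dn xs]]]]] := sP x.
  exists (pickle (m, i, j, n)); rewrite pickleK.
  by have [_ + _] := GP (m, i, j, n); apply.
Qed.
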